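(* Let $\rho_k > 0$ and let $x_{kj} \in \mathbb{R}^n$ be a feasible point of the penalized problem $$\min_{x\in\mathbb{R}^n}\ \tfrac12 x^\top Q x + g^\top x + \rho_k\, \varphi(x)\quad\text{s.t.}\quad 0\le Ax-b,\ \ 0\le Lx,\ \ 0\le Rx. \qquad (\mathrm{P}_{\rho_k})$$ Let $x_{kj}^\ast$ be the unique minimizer of the convex quadratic program $$\min_{x\in\mathbb{R}^n}\ \tfrac12 x^\top Q x + (g+\rho_k C x_{kj})^\top x\quad\text{s.t.}\quad 0\le Ax-b,\ \ 0\le Lx,\ \ 0\le Rx,$$ and let $p_{kj} = x_{kj}^\ast - x_{kj}$. Then the merit function $\psi(\cdot,\rho_k)$ is nonincreasing at $x_{kj}$ in the direction $p_{kj}$, i.e. $$\nabla \psi(x_{kj},\rho_k)^\top (x_{kj}^\ast - x_{kj}) \le 0,$$ where $\nabla$ denotes the gradient with respect to $x$. Further, if $x_{kj}$ is not a stationary point of $(\mathrm{P}_{\rho_k})$, then $$\nabla \psi(x_{kj},\rho_k)^\top (x_{kj}^\ast - x_{kj}) < 0.$$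
   Context: Data: $Q\in\mathbb{R}^{n\times n}$ is symmetric positive definite, $g\in\mathbb{R}^n$, $A\in\mathbb{R}^{n_A\times n}$, $b\in\mathbb{R}^{n_A}$, and $L,R\in\mathbb{R}^{n_C\times n}$. Vector inequalities are componentwise. Define $C = L^\top R + R^\top L\in\mathbb{R}^{n\times n}$ (symmetric, usually indefinite), and the penalty function $\varphi(x) = x^\top L^\top R x = \tfrac12 x^\top C x$. The merit function is $\psi(x,\rho) = \tfrac12 x^\top (Q+\rho C) x + g^\top x$; it coincides with the objective of the penalized problem with penalty parameter $\rho$. A stationary point of $(\mathrm{P}_{\rho_k})$ means a KKT point: a feasible $x$ for which there exist multipliers $y_A\in\mathbb{R}^{n_A}$, $y_L,y_R\in\mathbb{R}^{n_C}$, all componentwise nonnegative, such that $(Q+\rho_k C)x + g - A^\top y_A - L^\top y_L - R^\top y_R = 0$ and $y_A^\top(Ax-b) = 0$, $y_L^\top Lx = 0$, $y_R^\top Rx = 0$. *)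

(* Defs.v *)
From HB Require Import structures.
From mathcomp Require Import all_boot all_order all_algebra.
From mathcomp Require Import all_classical all_reals all_analysis.

Set Implicit Arguments.
Unset Strict Implicit.
Unset Printing Implicit Defensive.
Import Order.TTheory GRing.Theory Num.Theory.
Import numFieldNormedType.Exports.
Local Open Scope ring_scope.

Definition dot (K : realType) (n : nat) (u v : 'cV[K]_n) : K :=
  (u^T *m v) 0 0.

Definition nonneg (K : realType) (n : nat) (v : 'cV[K]_n) : Prop :=
  forall i, 0 <= v i 0.

Definition sym_posdef (K : realType) (n : nat) (Q : 'M[K]_n) : Prop :=
  Q^T = Q /\ forall x : 'cV[K]_n, x != 0 -> 0 < dot x (Q *m x).

(* The vector of partial derivatives; the library's Jacobian is restricted to
   functions between spaces of row vectors. *)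
Definition grad (K : realType) (n : nat) (f : 'cV[K]_n -> K) (x : 'cV[K]_n) :
    'cV[K]_n :=
  \col_i 'D_(delta_mx i 0) f x.

Definition is_minimizer (K : realType) (T : Type) (D : set T) (f : T -> K)
    (x : T) : Prop :=
  D x /\ forall y, D y -> f x <= f y.

Definition quad_obj (K : realType) (n : nat) (H : 'M[K]_n) (g x : 'cV[K]_n) :
    K :=
  2^-1 * dot x (H *m x) + dot g x.

Definition feasible (K : realType) (n nA nC : nat) (A : 'M[K]_(nA, n))
    (b : 'cV[K]_nA) (L R : 'M[K]_(nC, n)) : set 'cV[K]_n :=
  [set x | [/\ nonneg (A *m x - b), nonneg (L *m x) & nonneg (R *m x)]]%classic.

Definition comp_mx (K : realType) (n nC : nat) (L R : 'M[K]_(nC, n)) :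
    'M[K]_n :=
  L^T *m R + R^T *m L.

Definition penalty (K : realType) (n nC : nat) (L R : 'M[K]_(nC, n))
    (x : 'cV[K]_n) : K :=
  dot x (L^T *m R *m x).

Definition merit (K : realType) (n nC : nat) (Q : 'M[K]_n) (g : 'cV[K]_n)
    (L R : 'M[K]_(nC, n)) (x : 'cV[K]_n) (rho : K) : K :=
  quad_obj (Q + rho *: comp_mx L R) g x.

Lemma penaltyE (K : realType) (n nC : nat) (L R : 'M[K]_(nC, n))
    (x : 'cV[K]_n) :
  penalty L R x = 2^-1 * dot x (comp_mx L R *m x).
Proof.
have sym : (x^T *m (R^T *m L *m x)) 0 0 = (x^T *m (L^T *m R *m x)) 0 0.
  have -> : x^T *m (L^T *m R *m x) = (x^T *m (R^T *m L *m x))^T.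
    by rewrite !trmx_mul !trmxK !mulmxA.
  by rewrite [RHS]mxE.
rewrite /penalty /dot /comp_mx mulmxDl mulmxDr [in RHS]mxE sym.
by rewrite mulrC mulrDl -splitr.
Qed.

Lemma meritE (K : realType) (n nC : nat) (Q : 'M[K]_n) (g : 'cV[K]_n)
    (L R : 'M[K]_(nC, n)) (x : 'cV[K]_n) (rho : K) :
  merit Q g L R x rho =
  2^-1 * dot x (Q *m x) + dot g x + rho * penalty L R x.
Proof.
rewrite penaltyE /merit /quad_obj /dot mulmxDl -scalemxAl mulmxDr -scalemxAr.
by rewrite !mxE mulrDr mulrCA addrAC.
Qed.

(* Karush-Kuhn-Tucker points of the problem of minimizing
   [merit Q g L R ^~ rho] over [feasible A b L R]. *)
Definition stationary (K : realType) (n nA nC : nat) (Q : 'M[K]_n)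
    (g : 'cV[K]_n) (A : 'M[K]_(nA, n)) (b : 'cV[K]_nA) (L R : 'M[K]_(nC, n))
    (rho : K) (x : 'cV[K]_n) : Prop :=
  feasible A b L R x /\
  exists (yA : 'cV[K]_nA) (yL yR : 'cV[K]_nC),
    [/\ nonneg yA /\ nonneg yL /\ nonneg yR,
        (Q + rho *: comp_mx L R) *m x + g
          - A^T *m yA - L^T *m yL - R^T *m yR = 0
      & [/\ dot yA (A *m x - b) = 0, dot yL (L *m x) = 0
          & dot yR (R *m x) = 0]].

(* Main.v *)
Require Import Defs.
From mathcomp Require Import all_boot all_order all_algebra.
From mathcomp Require Import all_classical all_reals all_analysis.
From mathcomp Require Import ring lra.
Set Implicit Arguments.
Unset Strict Implicit.
Unset Printing Implicit Defensive.
Import Order.TTheory GRing.Theory Num.Theory.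
Import numFieldNormedType.Exports.
Local Open Scope ring_scope.

(** The gradient of the merit function at [x] is [d = Q x + h] with
    [h = g + rho C x], which is also the gradient at [x] of the convex quadratic
    [q] that the subproblem minimizes: linearizing the penalty at [x] keeps
    first-order information ([grad_quad_obj]).  Since [q] is quadratic, its
    second-order expansion along [p = xs - x] is exact ([quad_objD]):
    [q xs - q x = d^T p + (1/2) p^T Q p].  The left side is nonpositive because
    [x] is feasible and [xs] is a minimizer, so [d^T p <= - (1/2) p^T Q p].
    This is negative unless [p = 0].

    If [p = 0], then [x] itself minimizes [q] over the polyhedron, and it has to
    be shown that [x] is a KKT point ([stationary_fixpoint]); as [q] and the
    merit function share their gradient at [x], the multipliers of the
    subproblem serve for the penalized problem.  No constraint qualification is
    involved, since the constraints are linear: every direction that does not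
    decrease the active constraints can be followed a little way inside the
    polyhedron ([feasible_step]), so [d] has a nonnegative inner product with it
    ([slope_ge0]), and Farkas' lemma ([farkas]) writes [d] as a nonnegative
    combination of the active constraint rows ([kkt_quad_obj]). *)

(** * Inner products *)

Lemma dotE (K : realType) (n : nat) (u v : 'cV[K]_n) :
  dot u v = \sum_i u i 0 * v i 0.
Proof. by rewrite /dot mxE; apply: eq_bigr => i _; rewrite mxE. Qed.

Lemma dotC (K : realType) (n : nat) (u v : 'cV[K]_n) : dot u v = dot v u.
Proof. by rewrite !dotE; apply: eq_bigr => i _; rewrite mulrC. Qed.

Lemma dotDr (K : realType) (n : nat) (u v w : 'cV[K]_n) :
  dot u (v + w) = dot u v + dot u w.
Proof. by rewrite /dot mulmxDr mxE. Qed.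

Lemma dotDl (K : realType) (n : nat) (u v w : 'cV[K]_n) :
  dot (u + v) w = dot u w + dot v w.
Proof. by rewrite dotC dotDr !(dotC w). Qed.

Lemma dotZr (K : realType) (n : nat) (c : K) (u v : 'cV[K]_n) :
  dot u (c *: v) = c * dot u v.
Proof. by rewrite /dot -scalemxAr mxE. Qed.

Lemma dotZl (K : realType) (n : nat) (c : K) (u v : 'cV[K]_n) :
  dot (c *: u) v = c * dot u v.
Proof. by rewrite dotC dotZr dotC. Qed.

Lemma dot_mulmx (K : realType) (m n : nat) (M : 'M[K]_(m, n))
    (u : 'cV[K]_m) (v : 'cV[K]_n) : dot u (M *m v) = dot (M^T *m u) v.
Proof. by rewrite /dot trmx_mul trmxK mulmxA. Qed.

Lemma dot_delta (K : realType) (n : nat) (u : 'cV[K]_n) (i : 'I_n) :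
  dot u (delta_mx i 0) = u i 0.
Proof.
rewrite dotE (bigD1 i) //= big1 ?addr0 => [|j ji].
  by rewrite mxE !eqxx mulr1.
by rewrite mxE (negbTE ji) mulr0.
Qed.

Lemma nonneg_col_mx (K : realType) (m n : nat) (u : 'cV[K]_m)
    (v : 'cV[K]_n) : nonneg (col_mx u v) <-> nonneg u /\ nonneg v.
Proof.
split=> [uv|[u0 v0] i].
  split=> i; first by have := uv (lshift n i); rewrite col_mxEu.
  by have := uv (rshift m i); rewrite col_mxEd.
by rewrite mxE; case: splitP => j _; [exact: u0 | exact: v0].
Qed.

(** * Quadratic functions *)

Lemma quad_objD (K : realType) (n : nat) (H : 'M[K]_n) (g x v : 'cV[K]_n) :
  H^T = H ->
  quad_obj H g (x + v) =
  quad_obj H g x + dot (H *m x + g) v + 2^-1 * dot v (H *m v).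
Proof.
move=> Hsym; rewrite /quad_obj mulmxDr !dotDr !dotDl.
have -> : dot x (H *m v) = dot (H *m x) v by rewrite dot_mulmx Hsym.
by rewrite (dotC v (H *m x)); field.
Qed.

(** Along a line through [x] the difference quotient with step [h] is
    [a + h * c], by the exact expansion, so its limit is the slope [a]. *)
Lemma grad_quad_obj (K : realType) (n : nat) (H : 'M[K]_n)
    (g x : 'cV[K]_n) :
  H^T = H -> grad (quad_obj H g) x = H *m x + g.
Proof.
move=> Hsym; apply/matrixP => i j; rewrite ord1 mxE.
rewrite -(dot_delta (H *m x + g) i).
set v := delta_mx i 0; rewrite /derive; apply: cvg_lim => //.
set a := dot _ v; set c := 2^-1 * dot v (H *m v).
have slopeE : forall h : K, h != 0 ->
    h^-1 *: (quad_obj H g (h *: v + x) - quad_obj H g x) = a + h * c.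
  move=> h h0; rewrite [h *: v + x]addrC quad_objD // dotZr -/a -scalemxAr dotZl dotZr.
  by rewrite /c /GRing.scale /=; field.
apply: (@cvg_trans _ ((fun h : K => a + h * c) @ 0^'))%classic.
  apply: near_eq_cvg; near=> h; rewrite /= slopeE //.
  by near: h; exact: nbhs_dnbhs_neq.
apply: cvg_trans (cvg_app _ (@nbhs_dnbhs _ 0)) _.
have -> : nbhs a = nbhs (a + 0 * c) by rewrite mul0r addr0.
by apply: cvgD; [exact: cvg_cst | apply: cvgMl; exact: cvg_id].
Unshelve. all: by end_near.
Qed.

(** * Farkas' lemma *)

(** Farkas' lemma, by induction on the number of constraints.  Split off a row
    [a].  If the other rows already force [d] to be nonnegative, [a] gets
    multiplier 0.  Otherwise some [v] satisfies the other rows and has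
    [d^T v < 0], hence [a v < 0], and it is rescaled to [u] with [a u = -1].
    Moving along [u] projects onto the hyperplane where [a] vanishes; pulling the
    other rows and [d] back along this projection gives a system with one
    constraint less, whose multipliers [y] determine that of [a]. *)
Lemma farkas (K : realType) (n m : nat) (M : 'M[K]_(m, n)) (d : 'cV[K]_n) :
  (forall v, nonneg (M *m v) -> 0 <= dot d v) ->
  exists2 y, nonneg y & d = M^T *m y.
Proof.
elim: m M d => [|m IH] M d dual.
  (* With no constraints, [d] is nonnegative on both e_i and - e_i. *)
  have d0 : d = 0.
    apply/matrixP => i j; rewrite ord1.
    have h v : 0 <= dot d v by apply: dual => -[].
    apply/eqP; rewrite eq_le !mxE; have := h (delta_mx i 0).
    rewrite dot_delta => ->; rewrite andbT -oppr_ge0.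
    by have := h ((-1) *: delta_mx i 0); rewrite dotZr dot_delta mulN1r.
  by exists 0; [move=> i; rewrite mxE | rewrite mulmx0].
move: M dual; rewrite -[m.+1]/(1 + m)%N => M.
rewrite -[M]vsubmxK; set a := usubmx M; set B := dsubmx M => dual.
have [dualB|] := pselect (forall v, nonneg (B *m v) -> 0 <= dot d v).
  have [y y0 ->] := IH B d dualB.
  exists (col_mx 0 y).
    by apply/nonneg_col_mx; split=> // i; rewrite mxE.
  by rewrite tr_col_mx mul_row_col mulmx0 add0r.
move=> /existsNP[v /not_implyP[Bv /negP]]; rewrite -ltNge => dv.
have aE (w : 'cV[K]_n) : a *m w = (dot a^T w)%:M.
  by rewrite /dot trmxK [LHS]mx11_scalar.
have av : dot a^T v < 0.
  rewrite ltNge; apply/negP => av; move: dv; rewrite ltNge => /negP; apply.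
  apply: dual; rewrite mul_col_mx; apply/nonneg_col_mx; split=> // i.
  by rewrite aE ord1 mxE.
pose u := (- dot a^T v)^-1 *: v.
have t0 : 0 < (- dot a^T v)^-1 by rewrite invr_gt0 oppr_gt0.
have Bu : nonneg (B *m u).
  by move=> i; rewrite -scalemxAr mxE mulr_ge0 ?(ltW t0).
have du : dot d u < 0 by rewrite dotZr pmulr_rlt0.
have au : dot a^T u = -1.
  by rewrite dotZr invrN mulNr mulVf // lt_eqF.
have [|y y0 dE] := IH (B + (B *m u) *m a) (d + dot d u *: a^T).
  move=> w Bw; rewrite dotDl dotZl mulrC -dotZr -dotDr.
  apply: dual; rewrite mul_col_mx; apply/nonneg_col_mx; split=> i.
    by rewrite aE ord1 mxE dotDr dotZr au mulrN1 subrr.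
  suff -> : B *m (w + dot a^T w *: u) = (B + B *m u *m a) *m w by [].
  by rewrite mulmxDr mulmxDl -mulmxA aE mul_mx_scalar -scalemxAr.
(* The multiplier of [a] is its coefficient once [d] is isolated in [dE]. *)
exists (col_mx (dot (B *m u) y - dot d u)%:M y).
  apply/nonneg_col_mx; split=> // i; rewrite ord1 mxE /= mulr1n.
  rewrite subr_ge0; apply: le_trans (ltW du) _.
  by rewrite dotE; apply: sumr_ge0 => j _; rewrite mulr_ge0.
rewrite tr_col_mx mul_row_col mul_mx_scalar.
move/(canRL (addrK _)): dE => dE; rewrite [LHS]dE.
rewrite linearD /= trmx_mul mulmxDl -mulmxA.
have -> : (B *m u)^T *m y = (dot (B *m u) y)%:M by rewrite [LHS]mx11_scalar.
by rewrite mul_mx_scalar scalerBl -addrA addrC.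
Qed.

(** * First-order conditions over a polyhedron *)

(** A slack [s i > 0] tolerates any step up to [s i / `|w i|].  Instead of the
    minimum of these ratios, the step is the inverse of one plus the sum of their
    inverses, to which the zero slacks contribute nothing as [x / 0 = 0]. *)
Lemma feasible_step (K : realType) (m : nat) (s w : 'cV[K]_m) :
  nonneg s -> (forall i, s i 0 = 0 -> 0 <= w i 0) ->
  exists2 t, 0 < t & forall u, 0 <= u <= t -> nonneg (s + u *: w).
Proof.
move=> s0 sw; pose r := \sum_i `|w i 0| / s i 0.
have r0 : 0 <= r by apply: sumr_ge0 => i _; rewrite mulr_ge0 ?invr_ge0.
exists (1 + r)^-1 => [|u /andP[u0 ut] i]; first by rewrite invr_gt0; lra.
rewrite !mxE; have [/eqP si|si] := boolP (s i 0 == 0).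
  by rewrite si add0r mulr_ge0 ?sw.
have {si} si : 0 < s i 0 by rewrite lt_neqAle eq_sym si s0.
have wr : `|w i 0| <= r * s i 0.
  rewrite -ler_pdivrMr // /r (bigD1 i) //= lerDl.
  by apply: sumr_ge0 => j _; rewrite mulr_ge0 ?invr_ge0.
have ur : u * (1 + r) <= 1 by rewrite -ler_pdivlMr ?div1r //; lra.
have uw : u * `|w i 0| <= s i 0.
  apply: (@le_trans _ _ (u * (1 + r) * s i 0)); last first.
    by rewrite ler_piMl // ltW.
  by rewrite -mulrA ler_wpM2l //; lra.
have : - (u * `|w i 0|) <= u * w i 0.
  by rewrite -mulrN ler_wpM2l // lerNl -normrN ler_norm.
lra.
Qed.

(** After division by [u], the slope is at least [- u * c], where [u] is
    arbitrarily small. *)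
Lemma slope_ge0 (K : realType) (t a c : K) :
  0 < t -> (forall u, 0 <= u <= t -> 0 <= u * a + u ^+ 2 * c) -> 0 <= a.
Proof.
move=> t0 h; apply/ler_addgt0Pr => e e0.
pose u := Num.min t (e / (1 + `|c|)).
have c1 : 0 < 1 + `|c| by have := normr_ge0 c; lra.
have u0 : 0 < u by rewrite lt_min t0 divr_gt0.
have uc : u * c <= e.
  have ue : u * (1 + `|c|) <= e by rewrite -ler_pdivlMr // ge_min lexx orbT.
  have : u * c <= u * `|c| by rewrite ler_pM2l // ler_norm.
  lra.
have := h u; rewrite ge_min lexx (ltW u0) => /(_ isT).
by rewrite expr2 -mulrA -mulrDr pmulr_rge0 //; lra.
Qed.

(** Multiplying [M] by the diagonal 0-1 matrix [D] that marks the active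
    constraints turns the inactive rows into zero rows, so that Farkas' lemma
    applies without changing the index set; the multipliers [D *m y] then vanish
    on the inactive constraints, which is complementary slackness. *)
Lemma kkt_quad_obj (K : realType) (n m : nat) (H : 'M[K]_n) (h : 'cV[K]_n)
    (M : 'M[K]_(m, n)) (c : 'cV[K]_m) (x : 'cV[K]_n) :
  H^T = H ->
  is_minimizer [set z | nonneg (M *m z - c)]%classic (quad_obj H h) x ->
  exists y, [/\ nonneg y, H *m x + h = M^T *m y
    & forall i, y i 0 * (M *m x - c) i 0 = 0].
Proof.
move=> Hsym [/= s0 xmin]; set s := M *m x - c in s0 *.
pose D := diag_mx (\row_i (s i 0 == 0)%:R : 'rV[K]_m).
have DE (w : 'cV[K]_m) i : (D *m w) i 0 = (s i 0 == 0)%:R * w i 0.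
  by rewrite mul_diag_mx !mxE.
have [|y y0 dE] := @farkas _ _ _ (D *m M) (H *m x + h).
  move=> v DMv.
  have [i si|t t0 step] := @feasible_step _ _ s (M *m v) s0.
    by have := DMv i; rewrite -mulmxA DE si eqxx mul1r.
  apply: (@slope_ge0 _ t _ (2^-1 * dot v (H *m v)) t0) => u /step su.
  have /xmin : nonneg (M *m (x + u *: v) - c).
    by rewrite mulmxDr -scalemxAr addrAC.
  rewrite quad_objD // dotZr -scalemxAr dotZr dotZl -addrA lerDl.
  by rewrite expr2; lra.
exists (D *m y); split=> [i||i].
- by rewrite DE mulr_ge0.
- by rewrite dE trmx_mul tr_diag_mx mulmxA.
- rewrite DE; have [->|_] := eqVneq (s i 0) 0; first by rewrite mulr0.
  by rewrite mul0r mul0r.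
Qed.

(** * The penalized problem and its linearization *)

Lemma feasible_col_mx (K : realType) (n nA nC : nat) (A : 'M[K]_(nA, n))
    (b : 'cV[K]_nA) (L R : 'M[K]_(nC, n)) :
  feasible A b L R =
  [set z | nonneg (col_mx A (col_mx L R) *m z - col_mx b 0)]%classic.
Proof.
apply/seteqP; split=> z /=; rewrite !mul_col_mx opp_col_mx add_col_mx subr0.
  by move=> [zA zL zR]; do 2![apply/nonneg_col_mx; split=> //].
by rewrite !nonneg_col_mx => -[? []].
Qed.

Lemma tr_comp_mx (K : realType) (n nC : nat) (L R : 'M[K]_(nC, n)) :
  (comp_mx L R)^T = comp_mx L R.
Proof. by rewrite /comp_mx linearD /= !trmx_mul !trmxK addrC. Qed.

(** The left side is the gradient of the merit function at [x], the right side
    that of the objective with the penalty linearized at [x]. *)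
Lemma linearized_gradE (K : realType) (n nC : nat) (Q : 'M[K]_n)
    (g : 'cV[K]_n) (L R : 'M[K]_(nC, n)) (rho : K) (x : 'cV[K]_n) :
  (Q + rho *: comp_mx L R) *m x + g =
  Q *m x + (g + rho *: (comp_mx L R *m x)).
Proof. by rewrite mulmxDl -scalemxAl -addrA [_ + g]addrC. Qed.

(** The objective minimized by [x] here depends on [x]; it has the gradient of
    the merit function at that point only, and KKT conditions see nothing else.
    Hence its multipliers are those of the penalized problem. *)
Lemma stationary_fixpoint (K : realType) (n nA nC : nat)
    (Q : 'M[K]_n) (g : 'cV[K]_n) (A : 'M[K]_(nA, n)) (b : 'cV[K]_nA)
    (L R : 'M[K]_(nC, n)) (rho : K) (x : 'cV[K]_n) :
  Q^T = Q ->
  is_minimizer (feasible A b L R)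
    (quad_obj Q (g + rho *: (comp_mx L R *m x))) x ->
  stationary Q g A b L R rho x.
Proof.
move=> Qsym xmin; split; first by case: xmin.
move: xmin; rewrite feasible_col_mx => /(kkt_quad_obj Qsym).
case=> y; rewrite -[y]vsubmxK -[dsubmx y]vsubmxK.
move: (usubmx y) (usubmx (dsubmx y)) (dsubmx (dsubmx y)) => yA yL yR.
case=> /nonneg_col_mx[yA0 /nonneg_col_mx[yL0 yR0]].
rewrite !tr_col_mx !mul_row_col => dE.
rewrite !mul_col_mx opp_col_mx add_col_mx subr0 => compl.
exists yA, yL, yR; split=> //.
  rewrite linearized_gradE dE.
  by rewrite -addrA -opprD -addrA -opprD subrr.
split; rewrite dotE big1 // => i _.
- by have := compl (lshift _ i); rewrite !col_mxEu.
- by have := compl (rshift _ (lshift _ i)); rewrite !(col_mxEd, col_mxEu).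
- by have := compl (rshift _ (rshift _ i)); rewrite !col_mxEd.
Qed.

Theorem lemma2 (K : realType) (n nA nC : nat)
    (Q : 'M[K]_n) (g : 'cV[K]_n) (A : 'M[K]_(nA, n)) (b : 'cV[K]_nA)
    (L R : 'M[K]_(nC, n)) (rho : K) (x xs : 'cV[K]_n)
    (hQ : sym_posdef Q)
    (hrho : 0 < rho)
    (hx : feasible A b L R x)
    (hxs : is_minimizer (feasible A b L R)
             (quad_obj Q (g + rho *: (comp_mx L R *m x))) xs) :
  dot (grad (fun z => merit Q g L R z rho) x) (xs - x) <= 0 /\
  (~ stationary Q g A b L R rho x ->
   dot (grad (fun z => merit Q g L R z rho) x) (xs - x) < 0).
Proof.
have [Qsym Qpos] := hQ.
rewrite grad_quad_obj; last first.
  by rewrite linearD linearZ /= Qsym tr_comp_mx.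
rewrite linearized_gradE.
move: (hxs); set h := g + _ => -[_ /(_ x hx)].
rewrite -{1}[xs](subrKC x) quad_objD // -addrA gerDl.
set d := Q *m x + h; set p := xs - x => decr.
have [p0|/Qpos pQp] := eqVneq p 0; last by split=> [|_]; lra.
have xsE : xs = x by apply/eqP; rewrite -subr_eq0 -/p p0.
split=> [|nstat]; first by rewrite p0 /dot mulmx0 mxE.
case: nstat; apply: stationary_fixpoint Qsym _.
by rewrite -[X in is_minimizer _ _ X]xsE.
Qed.
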